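(* For any $\gamma\in(0,\gamma_g)$, the forward-backward envelope $\varphi_\gamma$ is a real-valued and strictly continuous function on $\mathbb{R}^n$.
   Context: Standing assumptions: $f:\mathbb{R}^n\to\mathbb{R}$ is differentiable with Lipschitz continuous gradient; $g:\mathbb{R}^n\to\mathbb{R}\cup\{+\infty\}$ is proper, lower semicontinuous and prox-bounded, meaning that $g+\frac{1}{2\gamma}\|\cdot\|^2$ is bounded below for some $\gamma>0$; $\gamma_g\in(0,+\infty]$ is the supremum of all such $\gamma$; $\varphi:=f+g$ and $\operatorname{argmin}\varphi\neq\emptyset$. Neither function need be convex. The forward-backward envelope with parameter $\gamma>0$ is $\varphi_\gamma(x):=\inf_{z\in\mathbb{R}^n}\{f(x)+\langle\nabla f(x),z-x\rangle+\frac{1}{2\gamma}\|z-x\|^2+g(z)\}$. A function $h:\mathbb{R}^n\to\mathbb{R}$ is strictly continuous at $\bar x$ if $\limsup_{y,z\to\bar x,\,y\ne z}\frac{|h(y)-h(z)|}{\|y-z\|}<\infty$ (i.e. it is Lipschitz around $\bar x$), and strictly continuous on a set if this holds at each of its points. *)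

(* Defs.v *)
From mathcomp Require Import all_boot all_order all_algebra.
From mathcomp Require Import all_classical all_reals all_analysis.

Set Implicit Arguments.
Unset Strict Implicit.
Unset Printing Implicit Defensive.

Import Order.TTheory GRing.Theory Num.Theory.
Import numFieldNormedType.Exports.

Local Open Scope classical_set_scope.
Local Open Scope ring_scope.

Section Definitions.
Context {R : realType} {n : nat}.
Implicit Types (f h : 'rV[R]_n -> R) (g phi : 'rV[R]_n -> \bar R).
Implicit Types (x y z u v : 'rV[R]_n) (gamma : R) (A : set 'rV[R]_n).

(* The library norm `|x| on 'rV[R]_n is the max norm, so the Euclidean
   structure is defined here. The topology and differentiability on 'rV[R]_n are
   still the library's: they do not depend on the norm chosen. *)
Definition dotv u v : R := \sum_(i < n) u 0 i * v 0 i.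

Definition enorm u : R := Num.sqrt (dotv u u).

Definition gradient f x : 'rV[R]_n := \row_(i < n) 'D_(delta_mx 0 i) f x.

Definition lipschitz_gradient f : Prop :=
  exists L : R, forall x y,
    enorm (gradient f x - gradient f y) <= L * enorm (x - y).

Definition proper_function g : Prop :=
  (forall x, g x != -oo%E) /\ (exists x, g x != +oo%E).

Definition bounded_below g : Prop :=
  exists m : R, forall x, (m%:E <= g x)%E.

Definition prox_parameters g : set R :=
  [set gamma | 0 < gamma /\
    bounded_below (fun x => g x + ((2 * gamma)^-1 * enorm x ^+ 2)%:E)%E].

Definition prox_bounded g : Prop := prox_parameters g !=set0.

Definition prox_threshold g : \bar R :=
  ereal_sup [set gamma%:E | gamma in prox_parameters g].

Definition argmin phi : set 'rV[R]_n :=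
  [set x | forall y, (phi x <= phi y)%E].

Definition forward_backward_envelope f g gamma x : \bar R :=
  ereal_inf (range (fun z : 'rV[R]_n =>
    (f x + dotv (gradient f x) (z - x)
     + (2 * gamma)^-1 * enorm (z - x) ^+ 2)%:E + g z)%E).

Definition strictly_continuous_at h x : Prop :=
  (limf_esup (fun p : 'rV[R]_n * 'rV[R]_n =>
      (`|h p.1 - h p.2| / enorm (p.1 - p.2))%:E)
    (within [set p | p.1 != p.2] (nbhs (x, x))) < +oo)%E.

Definition strictly_continuous_on A h : Prop :=
  forall x, A x -> strictly_continuous_at h x.

End Definitions.

(* Main.v *)
(* Expanding the square, phi_gamma(x) = inf_z (b(x) + <v(x), z> + psi(z)) with
   psi = g + |.|^2 / (2 gamma), where v = grad f - id / gamma and b are locally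
   Lipschitz. Since gamma < gamma_g, psi dominates a multiple of |.|^2 with
   positive coefficient up to a constant, so the infimum is finite and, as long
   as v(x) is bounded, only the z in a fixed ball matter. On that ball the
   infimand is Lipschitz in (v, b), uniformly in z, and so is the infimum. *)
Require Import Defs.
From mathcomp Require Import all_boot all_order all_algebra.
From mathcomp Require Import all_classical all_reals all_analysis.
From mathcomp Require Import ring lra.

Import Order.TTheory GRing.Theory Num.Theory.
Import numFieldNormedType.Exports.

Local Open Scope classical_set_scope.
Local Open Scope ring_scope.

(** * Euclidean inner product and norm, compared with the ambient topology *)

Section EuclideanStructure.
Context {R : realType} {n : nat}.
Implicit Types u v w x y z : 'rV[R]_n.

Lemma dotvC u v : dotv u v = dotv v u.
Proof. by apply: eq_bigr => i _; rewrite mulrC. Qed.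

Lemma dotvDl u v w : dotv (u + v) w = dotv u w + dotv v w.
Proof. by rewrite /dotv -big_split; apply: eq_bigr => i _; rewrite mxE mulrDl. Qed.

Lemma dotvZl (a : R) u w : dotv (a *: u) w = a * dotv u w.
Proof. by rewrite /dotv mulr_sumr; apply: eq_bigr => i _; rewrite mxE mulrA. Qed.

Lemma dotvNl u w : dotv (- u) w = - dotv u w.
Proof. by rewrite -scaleN1r dotvZl mulN1r. Qed.

Lemma dotvDr u v w : dotv u (v + w) = dotv u v + dotv u w.
Proof. by rewrite dotvC dotvDl !(dotvC u). Qed.

Lemma dotvZr (a : R) u w : dotv u (a *: w) = a * dotv u w.
Proof. by rewrite dotvC dotvZl dotvC. Qed.

Lemma dotvNr u w : dotv u (- w) = - dotv u w.
Proof. by rewrite dotvC dotvNl dotvC. Qed.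

Lemma dotvv_ge0 u : 0 <= dotv u u.
Proof. by apply: sumr_ge0 => i _; rewrite -expr2 sqr_ge0. Qed.

Lemma enorm_ge0 u : 0 <= enorm u.
Proof. exact: sqrtr_ge0. Qed.

Lemma sqr_enorm u : enorm u ^+ 2 = dotv u u.
Proof. exact/sqr_sqrtr/dotvv_ge0. Qed.

Lemma enormN u : enorm (- u) = enorm u.
Proof. by rewrite /enorm dotvNl dotvNr opprK. Qed.

Lemma enormBC u v : enorm (u - v) = enorm (v - u).
Proof. by rewrite -opprB enormN. Qed.

Lemma enormZ (a : R) u : enorm (a *: u) = `|a| * enorm u.
Proof.
by rewrite /enorm dotvZl dotvZr mulrA -expr2 sqrtrM ?sqr_ge0// sqrtr_sqr.
Qed.

(** Cauchy-Schwarz: for nonzero [u], the squared norm of |u|^2 v - <u,v> u is nonnegative and equals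
    |u|^2 (|u|^2 |v|^2 - <u,v>^2), so the factor |u|^2 can be cancelled. *)
Lemma dotv_le_enorm u v : `|dotv u v| <= enorm u * enorm v.
Proof.
rewrite -(@ler_pXn2r _ 2)// ?nnegrE ?mulr_ge0 ?enorm_ge0//.
rewrite real_normK ?num_real// exprMn !sqr_enorm.
have [u0|u0] := eqVneq (dotv u u) 0.
  suff -> : dotv u v = 0 by rewrite expr0n u0 mul0r.
  rewrite /dotv big1// => i _; apply/eqP; rewrite mulf_eq0 -(sqrf_eq0 (u 0 i)).
  move/eqP: u0; rewrite psumr_eq0 => [/allP/(_ i)|j _]; last first.
    by rewrite -expr2 sqr_ge0.
  by rewrite mem_index_enum -expr2 => /(_ isT) /= ->.
have := dotvv_ge0 (dotv u u *: v - dotv u v *: u).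
rewrite !(dotvDl, dotvDr, dotvNl, dotvNr, dotvZl, dotvZr) (dotvC v u).
have up : 0 < dotv u u by rewrite lt0r u0 dotvv_ge0.
set a := dotv u u in up *; set b := dotv u v; set c := dotv v v => h.
rewrite -subr_ge0 -(pmulr_rge0 _ up); apply: le_trans h _.
by rewrite le_eqVlt; apply/orP; left; apply/eqP; ring.
Qed.

Lemma dotv_le u v : dotv u v <= enorm u * enorm v.
Proof. exact: le_trans (ler_norm _) (dotv_le_enorm u v). Qed.

Lemma enormD u v : enorm (u + v) <= enorm u + enorm v.
Proof.
rewrite -(@ler_pXn2r _ 2)// ?nnegrE ?addr_ge0 ?enorm_ge0//.
rewrite sqrrD !sqr_enorm !(dotvDl, dotvDr) (dotvC v u).
by have := dotv_le u v; lra.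
Qed.

Lemma enormB u v : enorm (u - v) <= enorm u + enorm v.
Proof. by rewrite -(enormN v) enormD. Qed.

(** The factor [n] is cruder than its square root, but any constant suffices to make Euclidean balls
    neighbourhoods. *)
Lemma enorm_le_norm u : enorm u <= n%:R * `|u|.
Proof.
rewrite -(@ler_pXn2r _ 2)// ?nnegrE ?mulr_ge0 ?enorm_ge0//.
have ui (i : 'I_n) : `|u 0 i| <= `|u|.
  by rewrite [leRHS]mx_normrE; exact: (le_bigmax _ _ (0, i)).
rewrite sqr_enorm /dotv.
apply: (@le_trans _ _ (\sum_(i < n) `|u| ^+ 2)).
  apply: ler_sum => i _; rewrite -expr2 -real_normK ?num_real//.
  by rewrite ler_pXn2r ?nnegrE.
rewrite sumr_const card_ord exprMn -[leLHS]mulr_natl ler_wpM2r ?sqr_ge0//.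
by rewrite -natrX ler_nat; case: (n) => // k; rewrite -{1}(expn1 k.+1) leq_pexp2l.
Qed.

Lemma nbhs_enorm x (r : R) : 0 < r -> nbhs x [set y | enorm (y - x) < r].
Proof.
(* Dividing by n + 1 instead of n keeps the radius positive in dimension 0. *)
move=> r0; apply/nbhs_ballP; exists (r / n.+1%:R) => /=; first exact: divr_gt0.
move=> y; rewrite -ball_normE /= => xy.
rewrite enormBC; apply: le_lt_trans (enorm_le_norm _) _.
apply: (@le_lt_trans _ _ (n.+1%:R * `|x - y|)).
  by rewrite ler_wpM2r// ler_nat.
by rewrite mulrC -ltr_pdivlMr.
Qed.

End EuclideanStructure.

(** * Infimum of a quadratically growing function plus an affine term *)

Section TiltedInfimum.
Context {R : realType} {n : nat}.
Context (psi : 'rV[R]_n -> \bar R) (m a : R) (z0 : 'rV[R]_n).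
Context (a_gt0 : 0 < a).
Context (psi_ge : forall z, ((m + a * enorm z ^+ 2)%:E <= psi z)%E).
Context (psi_z0 : psi z0 \is a fin_num).

Definition tilted_inf (v : 'rV[R]_n) (b : R) : \bar R :=
  ereal_inf (range (fun z => (b + dotv v z)%:E + psi z)%E).

Lemma tilted_inf_fin_num v b : tilted_inf v b \is a fin_num.
Proof.
have lo : ((b + m - enorm v ^+ 2 / a)%:E <= tilted_inf v b)%E.
  apply: le_ereal_inf_tmp => _ [z _ <-].
  apply: le_trans (leeD2l _ (psi_ge z)); rewrite -EFinD lee_fin.
  have := dotv_le (- v) z; rewrite dotvNl enormN => d.
  suff : 0 <= a * enorm z ^+ 2 - enorm v * enorm z + enorm v ^+ 2 / a by lra.
  set s := enorm z; set t := enorm v; rewrite -(pmulr_rge0 _ a_gt0).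
  (* Completing the square in |z|; the non-optimal constant |v|^2 / a leaves the spare term 3/4
     t^2. *)
  have -> : a * (a * s ^+ 2 - t * s + t ^+ 2 / a) =
    (a * s - t / 2) ^+ 2 + 3 / 4 * t ^+ 2 by field; exact: lt0r_neq0.
  by apply: addr_ge0; [exact: sqr_ge0|apply: mulr_ge0; [lra|exact: sqr_ge0]].
have hi : (tilted_inf v b <= (b + dotv v z0 + fine (psi z0))%:E)%E.
  by apply: ereal_inf_lbound; exists z0 => //; rewrite -{1}(fineK psi_z0).
by rewrite fin_numE -ltNye -ltey (lt_le_trans _ lo) ?ltNyr// (le_lt_trans hi) ?ltry.
Qed.

(* Outside the ball of radius [rho] the quadratic growth of [psi] makes [z0] a
   better candidate than [z], whatever the slopes bounded by [V]. *)
Lemma tilted_inf_lipschitz (V : R) : 0 <= V -> exists2 rho : R, 0 <= rho &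
  forall v w b c, enorm v <= V -> enorm w <= V ->
  (tilted_inf w c <= tilted_inf v b + (c - b + rho * enorm (w - v))%:E)%E.
Proof.
(* [M] bounds <w, z0> + psi z0 for every |w| <= V. The radius [rho] is such that |z| > rho gives
   both a |z| - V >= |M - m| and |z| >= 1, hence a |z|^2 - V |z| >= M - m. *)
move=> V0; pose M := V * enorm z0 + fine (psi z0).
pose rho := (V + `|M - m|) / a + 1.
have rho1 : 1 <= rho by rewrite lerDr divr_ge0 ?addr_ge0// ltW.
exists rho; first by rewrite (le_trans _ rho1).
move=> v w b c vV wV; rewrite -leeBlDr//; apply: le_ereal_inf_tmp => _ [z _ <-].
rewrite leeBlDr//; have wv0 := enorm_ge0 (w - v).
have [zr|zr] := leP (enorm z) rho.
  (* Inside the ball the same [z] serves as candidate for (w, c), and the infimand changes by c - b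
     + <w - v, z>. *)
  apply: (@le_trans _ _ ((c + dotv w z)%:E + psi z)%E).
    by apply: ereal_inf_lbound; exists z.
  rewrite addeAC -EFinD leeD2r// lee_fin.
  have := dotv_le (w - v) z; rewrite dotvDl dotvNl => d.
  have : enorm (w - v) * enorm z <= rho * enorm (w - v).
    by rewrite mulrC ler_wpM2r.
  by lra.
apply: (@le_trans _ _ ((c + dotv w z0 + fine (psi z0))%:E)).
  by apply: ereal_inf_lbound; exists z0 => //; rewrite -{1}(fineK psi_z0).
rewrite addeAC -EFinD; apply: le_trans (leeD2l _ (psi_ge z)).
rewrite -EFinD lee_fin.
have z00 := enorm_ge0 z0.
have := dotv_le (- v) z; rewrite dotvNl enormN => d1.
have d2 := dotv_le w z0.
have d3 : enorm w * enorm z0 <= V * enorm z0 by rewrite ler_wpM2r.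
have d4 : enorm v * enorm z <= V * enorm z by rewrite ler_wpM2r ?enorm_ge0.
have d5 : M - m <= a * enorm z ^+ 2 - V * enorm z.
  have zr' : V + `|M - m| + a <= a * enorm z.
    have -> : V + `|M - m| + a = a * rho by rewrite /rho; field; exact: lt0r_neq0.
    by apply: ler_wpM2l; exact: ltW.
  apply: le_trans (ler_norm _) _.
  have -> : a * enorm z ^+ 2 - V * enorm z = (a * enorm z - V) * enorm z by ring.
  apply: (@le_trans _ _ (`|M - m| * 1)); first by rewrite mulr1.
  by apply: ler_pM => //; [move: zr' a_gt0; clear; lra|apply: le_trans rho1 (ltW zr)].
have : 0 <= rho * enorm (w - v) by rewrite mulr_ge0// (le_trans _ rho1).
by rewrite /M in d5; lra.
Qed.

End TiltedInfimum.

(** * Gradients along segments, local Lipschitz bounds, and the envelope as a tilted infimum *)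

Section Calculus.
Context {R : realType} {n : nat}.
Implicit Types (f h : 'rV[R]_n -> R) (g : 'rV[R]_n -> \bar R).
Implicit Types (x y z v w : 'rV[R]_n).

Lemma derive_dotv_gradient f x v : differentiable f x ->
  'D_v f x = dotv (gradient f x) v.
Proof.
move=> fx; rewrite deriveE// {1}(row_sum_delta v) linear_sum.
by apply: eq_bigr => i _; rewrite linearZ /= mxE deriveE// mulrC.
Qed.

Lemma is_derive_line f x w (t : R) : differentiable f (x + t *: w) ->
  is_derive t 1 (fun s : R => f (x + s *: w))
    (dotv (gradient f (x + t *: w)) w).
Proof.
move=> fd; have dw := @diff_derivable _ _ _ f _ w fd.
(* The difference quotient of the restriction to the line at [t] is the quotient of [f] at x + t w
   in direction [w], so derivability and value both transfer. *)
have E : (fun s : R => s^-1 *: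
    (((fun r : R => f (x + r *: w)) \o shift t) (s *: 1) - f (x + t *: w))) =
  (fun s : R => s^-1 *: ((f \o shift (x + t *: w)) (s *: w) - f (x + t *: w))).
  apply/funext => s /=; congr (_ *: (f _ - _)).
  by rewrite /shift /= scalerDl -[s *: 1]/(s * 1) mulr1 addrCA.
split; first by rewrite /derivable E; exact: dw.
by rewrite -derive_dotv_gradient// /derive E.
Qed.

Lemma mean_value_gradient f x y : (forall z, differentiable f z) ->
  exists2 t : R, 0 <= t <= 1 &
    f y - f x = dotv (gradient f (x + t *: (y - x))) (y - x).
Proof.
move=> fd; pose h (s : R) := f (x + s *: (y - x)).
have hd (t : R) := @is_derive_line f x (y - x) t (fd _).
have [|t t01] := @MVT_segment R h _ 0 1 ler01 (fun t _ => hd t).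
- by apply: derivable_within_continuous => t _; apply: ex_derive.
- rewrite /h scale1r scale0r addr0 subr0 mulr1 (addrC x (y - x)) subrK.
  by exists t; rewrite ?in_itv in t01 *.
Qed.

(** The one-sided estimate is enough because [y] and [z] can be exchanged. The limsup is an infimum
    of suprema over the sets of the filter, and [A] is one of these sets. *)
Lemma lipschitz_near_strictly_continuous h x (r K : R) : 0 < r -> 0 <= K ->
  (forall y z, enorm (y - x) < r -> enorm (z - x) < r ->
    h y <= h z + K * enorm (y - z)) ->
  strictly_continuous_at h x.
Proof.
move=> r0 K0 hK; apply: (@le_lt_trans _ _ K%:E); last exact: ltry.
have B := nbhs_enorm x r r0.
pose A := [set p : 'rV[R]_n * 'rV[R]_n |
  [/\ p.1 != p.2, enorm (p.1 - x) < r & enorm (p.2 - x) < r]].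
apply: (@le_trans _ _ (ereal_sup
    [set (`|h p.1 - h p.2| / enorm (p.1 - p.2))%:E | p in A])).
  apply: ereal_inf_lbound; eexists; last by [].
  exists ([set y | enorm (y - x) < r], [set y | enorm (y - x) < r]) => //=.
  by move=> [y z] [/= ? ?] ?.
apply: ge_ereal_sup => _ [[y z] [/= _ yr zr] <-]; rewrite lee_fin.
have : `|h y - h z| <= K * enorm (y - z).
  have := hK _ _ yr zr; have := hK _ _ zr yr; rewrite (enormBC z y) => *.
  by rewrite ler_norml; lra.
(* At zero distance the quotient is 0 by convention, so definiteness of the norm need not be
   invoked. *)
have := enorm_ge0 (y - z); rewrite le_eqVlt => /predU1P[<- _|p].
  by rewrite invr0 mulr0.
by rewrite ler_pdivrMr.
Qed.

(** The slope coefficient 1 / gamma is left as [2 * (2 * gamma)^-1], so that the identity is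
    polynomial in [(2 * gamma)^-1] and requires no condition on [gamma]. *)
Lemma forward_backward_envelopeE f g (gamma : R) x :
  forward_backward_envelope f g gamma x =
  tilted_inf (fun z => ((2 * gamma)^-1 * enorm z ^+ 2)%:E + g z)%E
    (gradient f x - (2 * (2 * gamma)^-1) *: x)
    (f x - dotv (gradient f x) x + (2 * gamma)^-1 * dotv x x).
Proof.
congr ereal_inf; apply: eq_imagel => z _.
rewrite addeA -EFinD; congr (_%:E + _)%E.
rewrite !sqr_enorm !(dotvDl, dotvDr, dotvNl, dotvNr, dotvZl) (dotvC z x).
by ring.
Qed.

(** A lower bound on g + a |.|^2 leaves the surplus (c - a) |.|^2 when the quadratic coefficient is
    [c]; it is used with c > a. *)
Lemma quadratic_growth g z (m a c : R) : proper_function g ->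
  (m%:E <= g z + (a * enorm z ^+ 2)%:E)%E ->
  ((m + (c - a) * enorm z ^+ 2)%:E <=
    (c * enorm z ^+ 2)%:E + g z)%E.
Proof.
move=> [gNy _]; move: (gNy z); case: (g z) => [s| |] // _.
- by rewrite -!EFinD !lee_fin; lra.
- by move=> _; rewrite addey// leey.
Qed.

End Calculus.

Theorem proposition4p2 (R : realType) (n : nat)
    (f : 'rV[R]_n -> R) (g : 'rV[R]_n -> \bar R)
    (f_diff : forall x : 'rV[R]_n, differentiable f x)
    (f_grad_lip : lipschitz_gradient f)
    (g_proper : proper_function g)
    (g_lsc : lower_semicontinuous g)
    (g_prox_bounded : prox_bounded g)
    (argmin_nonempty : argmin (fun x => ((f x)%:E + g x)%E) !=set0)
    (gamma : R) (gamma_gt0 : 0 < gamma)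
    (gamma_lt : (gamma%:E < prox_threshold g)%E) :
  (forall x : 'rV[R]_n, forward_backward_envelope f g gamma x \is a fin_num) /\
  strictly_continuous_on setT
    (fun x => fine (forward_backward_envelope f g gamma x)).
Proof.
have [L L0 gradL] : exists2 L : R, 0 <= L & forall x y,
    enorm (gradient f x - gradient f y) <= L * enorm (x - y).
  have [L gradL] := f_grad_lip; exists `|L| => // x y.
  by apply: le_trans (gradL x y) _; rewrite ler_wpM2r ?enorm_ge0 ?ler_norm.
(* Being below the supremum leaves room for an admissible gamma' > gamma; the gap between 1 / (2
   gamma) and 1 / (2 gamma') is the growth coefficient. *)
have [_ [gamma' [gamma'0 [m gm]] <-]] := ereal_sup_gt gamma_lt.
rewrite lte_fin => gg'.
set c := (2 * gamma)^-1; have c0 : 0 < c by rewrite invr_gt0 mulr_gt0.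
have a0 : 0 < c - (2 * gamma')^-1.
  by rewrite subr_gt0 ltf_pV2 ?posrE ?mulr_gt0// ltr_pM2l.
pose psi z := ((c * enorm z ^+ 2)%:E + g z)%E.
have psi_ge z := quadratic_growth g z m _ c g_proper (gm z).
have [gNy [z0 gz0]] := g_proper.
have psi0 : psi z0 \is a fin_num by rewrite fin_numD/= fin_numE gNy gz0.
pose v x := gradient f x - (2 * c) *: x.
pose b x := f x - dotv (gradient f x) x + c * dotv x x.
have fbeE x : forward_backward_envelope f g gamma x = tilted_inf psi (v x) (b x).
  exact: forward_backward_envelopeE.
have fbe_fin x : forward_backward_envelope f g gamma x \is a fin_num.
  by rewrite fbeE; exact: tilted_inf_fin_num a0 psi_ge psi0 _ _.
split=> // x _.
(* On the unit ball around [x], [G] bounds the gradient and [r] bounds the norm. *)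
pose G := enorm (gradient f x) + L; pose r := enorm x + 1.
have G0 : 0 <= G by rewrite addr_ge0 ?enorm_ge0.
have r0 : 0 <= r by rewrite addr_ge0 ?enorm_ge0.
have grad_le y : enorm (y - x) <= 1 -> enorm (gradient f y) <= G.
  move=> yx; rewrite -(subrK (gradient f x) (gradient f y)) addrC.
  apply: le_trans (enormD _ _) _; rewrite lerD2l.
  by apply: le_trans (gradL _ _) _; rewrite ler_piMr.
have norm_le y : enorm (y - x) <= 1 -> enorm y <= r.
  move=> yx; rewrite -(subrK x y) addrC.
  by apply: le_trans (enormD _ _) _; rewrite lerD2l.
have v_le y : enorm (y - x) <= 1 -> enorm (v y) <= G + 2 * c * r.
  move=> yx; apply: le_trans (enormB _ _) _; apply: lerD; first exact: grad_le.
  by rewrite enormZ gtr0_norm ?mulr_gt0// ler_pM2l ?mulr_gt0// norm_le.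
have v_lip y z : enorm (v y - v z) <= (L + 2 * c) * enorm (y - z).
  have -> : v y - v z = gradient f y - gradient f z - (2 * c) *: (y - z).
    by rewrite /v scalerBr !opprB addrACA [RHS]addrACA [- _ + _ in RHS]addrC.
  apply: le_trans (enormB _ _) _; rewrite [leRHS]mulrDl lerD ?gradL//.
  by rewrite enormZ gtr0_norm ?mulr_gt0.
have f_lip y z : enorm (y - x) <= 1 -> enorm (z - x) <= 1 ->
    f y - f z <= G * enorm (y - z).
  move=> yx zx; have [t /andP[t0 t1] ->] := mean_value_gradient f z y f_diff.
  apply: le_trans (dotv_le _ _) _; rewrite ler_wpM2r ?enorm_ge0//.
  apply: grad_le.
  (* By convexity, the intermediate point stays in the unit ball around [x], where [G] applies. *)
  have -> : z + t *: (y - z) - x = (1 - t) *: (z - x) + t *: (y - x).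
    by apply/rowP => i; rewrite !mxE; ring.
  apply: le_trans (enormD _ _) _.
  rewrite !enormZ ger0_norm ?subr_ge0// (ger0_norm t0).
  have : (1 - t) * enorm (z - x) <= (1 - t) * 1 by rewrite ler_wpM2l ?subr_ge0.
  have : t * enorm (y - x) <= t * 1 by rewrite ler_wpM2l.
  by lra.
have b_lip y z : enorm (y - x) <= 1 -> enorm (z - x) <= 1 ->
    b y - b z <= (2 * G + L * r + 2 * c * r) * enorm (y - z).
  move=> yx zx; have d0 := enorm_ge0 (y - z).
  (* Telescoping the products, with |y|^2 - |z|^2 = <y - z, y + z>, puts a difference in every term;
     the bounds are G, L r, G and 2 c r. *)
  have -> : b y - b z = (f y - f z) + dotv (gradient f y - gradient f z) (- y)
      + dotv (gradient f z) (z - y) + c * dotv (y - z) (y + z).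
    rewrite /b !(dotvDl, dotvDr, dotvNl, dotvNr) (dotvC z y); ring.
  have e1 := f_lip _ _ yx zx.
  have e2 : dotv (gradient f y - gradient f z) (- y) <= L * r * enorm (y - z).
    apply: le_trans (dotv_le _ _) _; rewrite enormN mulrAC.
    by apply: ler_pM; rewrite ?enorm_ge0 ?gradL ?norm_le.
  have e3 : dotv (gradient f z) (z - y) <= G * enorm (y - z).
    apply: le_trans (dotv_le _ _) _; rewrite (enormBC z y).
    by rewrite ler_wpM2r ?grad_le.
  have e4 : c * dotv (y - z) (y + z) <= c * (enorm (y - z) * (r + r)).
    rewrite ler_wpM2l ?(ltW c0)//; apply: le_trans (dotv_le _ _) _.
    by rewrite ler_wpM2l//; apply: le_trans (enormD _ _) _; rewrite lerD ?norm_le.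
  by move: e1 e2 e3 e4; clear; lra.
have V0 : 0 <= G + 2 * c * r by rewrite addr_ge0// !mulr_ge0// ltW.
have [rho rho0 lip] := tilted_inf_lipschitz psi m _ z0 a0 psi_ge psi0 _ V0.
(* The Lipschitz constant of [b], plus [rho] times that of [v]. *)
pose K := 2 * G + L * r + 2 * c * r + rho * (L + 2 * c).
have K0 : 0 <= K.
  have := mulr_ge0 (ltW c0) r0; have := mulr_ge0 L0 r0.
  have := mulr_ge0 rho0 L0; have := mulr_ge0 rho0 (ltW c0).
  by rewrite /K; move: G0; clear; lra.
apply: (lipschitz_near_strictly_continuous _ x 1 K ltr01 K0) => y z yx zx.
have /ltW yx' := yx; have /ltW zx' := zx.
rewrite -lee_fin EFinD !fineK//.
rewrite !fbeE; apply: le_trans (lip (v z) (v y) (b z) (b y) _ _) _; [exact: v_le..|].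
by rewrite leeD2l// lee_fin /K [leRHS]mulrDl lerD ?b_lip// -mulrA ler_wpM2l.
Qed.
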